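(* Let $G$ be a connected graph, $r\in V(G)$, $\mathcal{P}=\{F_1,\dots,F_t\}$ a partition of $E(G)$, and $g_1,\dots,g_t\in\mathbb{Z}_2^k$. For an edge $e\in F_j$ write $\mathrm{class}(e)=j$. The labeling $$\lambda(v)=\sum_{e\in P(r,v)} g_{\mathrm{class}(e)}\in\mathbb{Z}_2^k$$ is well defined (i.e. independent of the path $P(r,v)$ chosen from $r$ to $v$, for every $v$) if and only if for every cycle $C=(e_1,\dots,e_\ell)$ of $G$ $$\sum_{i=1}^{\ell} g_{\mathrm{class}(e_i)}=\mathbf{0}\in\mathbb{Z}_2^k .$$ Moreover, it suffices to verify this condition on the cycles of any cycle basis of $G$.
   Context: Graphs are finite, simple, connected and undirected. A cycle basis of $G$ is a set of cycles whose edge sets form a basis over $\mathbb{F}_2$ of the cycle space of $G$. *)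

(* Defs.v *)
From mathcomp Require Import all_boot all_algebra.

Set Implicit Arguments.
Unset Strict Implicit.
Unset Printing Implicit Defensive.

Import GRing.Theory.
Local Open Scope ring_scope.

Definition edges (T : finType) (adj : rel T) : {set {set T}} :=
  [set [set x; y] | x in T, y in T & adj x y].

(* As usual in [path.v], the path visiting x, p_1, ..., p_n is given by its
   start x and the remaining vertices p; paths do not repeat vertices. *)
Definition is_path (T : finType) (adj : rel T) (x y : T) (p : seq T) : bool :=
  [&& path adj x p, last x p == y & uniq (x :: p)].

Definition path_edges (T : finType) (x : T) (p : seq T) : seq {set T} :=
  pairmap (fun y z => [set y; z]) x p.

(* [ucycle] also holds of the empty sequence and of back-and-forth walks
   [:: x; y], hence the bound on the length. *)
Definition is_cycle (T : finType) (adj : rel T) (c : seq T) : bool :=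
  ucycleb adj c && (2 < size c)%N.

Definition cycle_edges (T : finType) (c : seq T) : seq {set T} :=
  [seq [set x; next c x] | x <- c].

Definition edge_class (T : finType) (t : nat) (F : 'I_t -> {set {set T}})
    (f : {set T}) : option 'I_t :=
  [pick j | f \in F j].

(* The default value 0 is only reached on sets that lie in no block F_j. *)
Definition class_sum (T : finType) (t k : nat) (F : 'I_t -> {set {set T}})
    (g : 'I_t -> 'rV['F_2]_k) (s : seq {set T}) : 'rV['F_2]_k :=
  \sum_(f <- s) oapp g 0 (edge_class F f).

Definition labeling_well_defined (T : finType) (adj : rel T) (r : T)
    (t k : nat) (F : 'I_t -> {set {set T}}) (g : 'I_t -> 'rV['F_2]_k) : Prop :=
  forall (v : T) (p q : seq T), is_path adj r v p -> is_path adj r v q ->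
    class_sum F g (path_edges r p) = class_sum F g (path_edges r q).

Definition incidence_mx (T : finType) (adj : rel T) :
    'M['F_2]_(#|edges adj|, #|T|) :=
  \matrix_(i < #|edges adj|, j < #|T|)
    ((enum_val j : T) \in (enum_val i : {set T}))%:R.

(* The kernel of the boundary map F_2^E -> F_2^V: the (indicator vectors of)
   sets of edges in which every vertex has even degree. *)
Definition cycle_space (T : finType) (adj : rel T) :
    {vspace 'rV['F_2]_#|edges adj|} :=
  lker (linfun (mulmxr (incidence_mx adj))).

Definition edge_vector (T : finType) (adj : rel T) (s : seq {set T}) :
    'rV['F_2]_#|edges adj| :=
  \row_(i < #|edges adj|) ((enum_val i : {set T}) \in s)%:R.

(* [basis_of] entails freeness, so the cycles listed in B have pairwise
   distinct edge sets. *)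
Definition is_cycle_basis (T : finType) (adj : rel T) (B : seq (seq T)) : bool :=
  all (is_cycle adj) B &&
  basis_of (cycle_space adj) [seq edge_vector adj (cycle_edges c) | c <- B].

(* Main.v *)
(** Fix an edge weight w with values in an abelian group of exponent 2.
    Independence of the path yields a potential l with w(uv) = l(u) + l(v) on
    every edge: a simple path from r to u either avoids v and extends to v, or
    passes through v, and then its initial segment up to v extends to u.  The
    weight of a walk then telescopes, so cycles have weight 0.  Conversely, if
    cycles have weight 0 then so do closed walks, by splitting at a repeated
    vertex, hence two paths with the same ends have equal weight.  For a cycle
    basis: the weight is the restriction of a linear map on F_2^E, and cycles
    lie in the cycle space because the incidence weight uv |-> 1_u + 1_v has a
    potential. *)
Require Import Defs.
From mathcomp Require Import all_boot all_algebra.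
From mathcomp Require Import zify.

Set Implicit Arguments.
Unset Strict Implicit.
Unset Printing Implicit Defensive.

Import GRing.Theory.
Local Open Scope ring_scope.

Lemma addrr_rVF2 n (v : 'rV['F_2]_n) : v + v = 0.
Proof.
apply/rowP=> j; rewrite !mxE.
by apply: (@addrr_pchar2 'F_2); rewrite pchar_Fp.
Qed.

Lemma addr_eq0_exp2 (V : zmodType) (addVV : forall v : V, v + v = 0) (a b : V) :
  a + b = 0 -> a = b.
Proof. by move=> ab0; rewrite -[a]addr0 -(addVV b) addrA ab0 add0r. Qed.

Lemma path_edges_cat (T : finType) (x : T) p q :
  path_edges x (p ++ q) = path_edges x p ++ path_edges (last x p) q.
Proof. exact: pairmap_cat. Qed.

(** [rev (belast x p)] lists what the reversed walk visits after its start [last x p]. Reversal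
    allows two paths with common ends to be glued into a closed walk. *)
Lemma sum_path_edges_rev (T : finType) (V : zmodType) (w : {set T} -> V) x p :
  \sum_(f <- path_edges (last x p) (rev (belast x p))) w f =
  \sum_(f <- path_edges x p) w f.
Proof.
elim: p x => [|y p IHp] x //=.
rewrite rev_cons -cats1 path_edges_cat big_cat /= IHp.
have -> : last (last y p) (rev (belast y p)) = y.
  by case: p {IHp} => //= z p; rewrite rev_cons last_rcons.
by rewrite /path_edges /= !big_cons big_nil addr0 addrC setUC.
Qed.

Lemma cycle_edges_path (T : finType) (x : T) p :
  uniq (x :: p) -> cycle_edges (x :: p) = path_edges x (rcons p x).
Proof.
move=> Up; apply: (@eq_from_nth _ set0) => [|i].
  by rewrite size_map size_pairmap size_rcons.
rewrite size_map => lt_i.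
rewrite (nth_map x) // (nth_pairmap x) ?size_rcons // -rcons_cons nth_rcons lt_i.
congr [set _; _].
rewrite next_nth mem_nth // index_uniq // nth_rcons.
(* At [i = size p] the edge closes the cycle: [nth] runs off [p] and its default [x] is the right
   endpoint. *)
case: ltngtP => // [lt_pi|->]; last by rewrite nth_default.
by move: lt_i; rewrite /= ltnS leqNgt lt_pi.
Qed.

Lemma is_cycle_uniq (T : finType) (adj : rel T) c : is_cycle adj c -> uniq c.
Proof. by case/andP=> /andP[]. Qed.

(** This is where the length bound on cycles matters: on two vertices, [next] is an involution. *)
Lemma next_next_neq (T : eqType) (c : seq T) (x : T) :
  uniq c -> (2 < size c)%N -> x \in c -> next c (next c x) != x.
Proof.
move=> Uc c_gt2 /rot_to[i c' def_c].
rewrite -!(next_rot i Uc) def_c.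
move: Uc c_gt2; rewrite -(rot_uniq i) -(size_rot i) def_c.
case: c' {def_c} => [|y [|z p]] //=; rewrite !inE !negb_or.
case/andP=> /and3P[xy xz _] _ _.
by rewrite !eqxx [y == x]eq_sym (negPf xy) eq_sym.
Qed.

(** If distinct [x] and [y] gave the same edge, each would be the successor of the other. *)
Lemma cycle_edges_uniq (T : finType) (adj : rel T) c :
  is_cycle adj c -> uniq (cycle_edges c).
Proof.
move=> cyc_c; have Uc := is_cycle_uniq cyc_c; case/andP: cyc_c => _ c_gt2.
rewrite map_inj_in_uniq // => x y cx cy /setP eq_xy.
apply/eqP; apply: contraT => neq_xy.
have:= eq_xy x; have:= eq_xy y.
rewrite !inE !eqxx [y == x]eq_sym (negPf neq_xy) /= => /eqP y_next /esym/eqP x_next.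
by have:= next_next_neq Uc c_gt2 cx; rewrite -y_next -x_next eqxx.
Qed.

Lemma cycle_edges_sub (T : finType) (adj : rel T) c :
  is_cycle adj c -> {subset cycle_edges c <= edges adj}.
Proof.
case/andP=> /andP[adj_c _] _ _ /mapP[x cx ->].
by apply: imset2_f; rewrite ?inE ?next_cycle.
Qed.

Lemma sum_path_edges_potential (T : finType) (adj : rel T) (V : zmodType)
    (addVV : forall v : V, v + v = 0) (w : {set T} -> V) (l : T -> V)
    (wl : forall u v, adj u v -> w [set u; v] = l u + l v) x p :
  path adj x p -> \sum_(f <- path_edges x p) w f = l x + l (last x p).
Proof.
elim: p x => [|y p IHp] x /= => [_|/andP[xy yp]].
  by rewrite big_nil addVV.
by rewrite /path_edges /= big_cons IHp // wl // addrA -(addrA (l x)) addVV addr0.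
Qed.

Lemma sum_cycle_edges_potential (T : finType) (adj : rel T) (V : zmodType)
    (addVV : forall v : V, v + v = 0) (w : {set T} -> V) (l : T -> V)
    (wl : forall u v, adj u v -> w [set u; v] = l u + l v) c :
  is_cycle adj c -> \sum_(f <- cycle_edges c) w f = 0.
Proof.
move=> cyc_c; have Uc := is_cycle_uniq cyc_c.
case/andP: cyc_c => /andP[]; case: c Uc => // x p Uc adj_c _ _.
rewrite cycle_edges_path // (sum_path_edges_potential addVV wl) //.
by rewrite last_rcons addVV.
Qed.

Lemma connect_is_path (T : finType) (adj : rel T) x y :
  connect adj x y -> exists p, is_path adj x y p.
Proof.
case/connectP=> p xp ->; case/shortenP: xp => q xq Uq _.
by exists q; rewrite /is_path xq eqxx.
Qed.

Lemma path_independent_potential (T : finType) (adj : rel T)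
    (adj_sym : symmetric adj) (adj_irr : irreflexive adj)
    (r : T) (r_conn : forall v, connect adj r v)
    (V : zmodType) (addVV : forall v : V, v + v = 0) (w : {set T} -> V)
    (w_indep : forall v p q, is_path adj r v p -> is_path adj r v q ->
       \sum_(f <- path_edges r p) w f = \sum_(f <- path_edges r q) w f) :
  exists l : T -> V, forall u v, adj u v -> w [set u; v] = l u + l v.
Proof.
pose P v := xchoose (connect_is_path (r_conn v)).
have PP v : is_path adj r v (P v) by apply: xchooseP.
pose l v := \sum_(f <- path_edges r (P v)) w f.
have lE v p : is_path adj r v p -> \sum_(f <- path_edges r p) w f = l v.
  by move=> rp; apply: w_indep rp (PP v).
have l_rcons u v p : is_path adj r u p -> adj u v -> v \notin r :: p ->
    l v = l u + w [set u; v].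
  move=> rp uv p'v; rewrite -(lE u p rp); case/and3P: rp => rp /eqP last_p Up.
  rewrite -(lE v (rcons p v)); first 1 last.
    by rewrite /is_path rcons_path rp last_p uv last_rcons eqxx -rcons_cons
               rcons_uniq p'v.
  by rewrite -cats1 path_edges_cat big_cat /= last_p big_seq1.
(* Exponent 2 turns the extension formula [l_rcons] into the potential equation. *)
have addK a b c : a = b + c -> c = b + a :> V.
  by move=> ->; rewrite addrA addVV add0r.
exists l => u v uv; have [|p'v] := boolP (v \in r :: P u); last first.
  by apply: addK; apply: l_rcons uv p'v.
move: (PP u); move: (P u) => p rp pv.
(* The segment of p from r to v avoids u, because u is the last vertex of p. *)
have [p1 [rp1 p1'u]] : exists p1, is_path adj r v p1 /\ u \notin r :: p1.
  have neq_uv : u != v by apply: contraTneq uv => ->; rewrite adj_irr.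
  case/splitPl: pv rp => p1 p2 last_p1 /and3P[].
  rewrite cat_path last_cat -cat_cons cat_uniq last_p1 => /andP[rp1 _].
  move=> last_p2 /and3P[Up1 /hasPn p12 _].
  exists p1; split; first by rewrite /is_path rp1 last_p1 eqxx.
  case: p2 last_p2 p12 => [|y p2] /=; first by rewrite eq_sym (negPf neq_uv).
  by move=> /eqP <- p12; apply: p12; apply: mem_last.
(* The roles of [u] and [v] are exchanged: [p1] ends at [v] and extends to [u]. *)
by rewrite addrC setUC; apply: addK; apply: l_rcons rp1 _ p1'u; rewrite adj_sym.
Qed.

Lemma not_uniq_split (T : eqType) (p : seq T) :
  ~~ uniq p -> exists p1 z p2 p3, p = p1 ++ z :: p2 ++ z :: p3.
Proof.
elim: p => //= x p IHp; rewrite negb_and negbK.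
case/orP=> [/splitPr[p1 p2] | /IHp[p1 [z [p2 [p3 ->]]]]].
  by exists [::], x, p1, p2.
by exists (x :: p1), z, p2, p3.
Qed.

Lemma sum_closed_walk_eq0 (T : finType) (adj : rel T)
    (adj_irr : irreflexive adj) (V : zmodType)
    (addVV : forall v : V, v + v = 0) (w : {set T} -> V)
    (w_cycle : forall c, is_cycle adj c -> \sum_(f <- cycle_edges c) w f = 0)
    x p :
  path adj x p -> last x p = x -> \sum_(f <- path_edges x p) w f = 0.
Proof.
elim: {p}(size p).+1 x {-2}p (ltnSn (size p)) => // n IHn x p lt_pn xp last_p.
have [Up|] := boolP (uniq p); last first.
  case/not_uniq_split=> p1 [z [p2 [p3 def_p]]].
  have def_p' : p = rcons p1 z ++ rcons p2 z ++ p3 by rewrite def_p !cat_rcons.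
  move: lt_pn xp last_p; rewrite {}def_p' {def_p} !size_cat !size_rcons !cat_path.
  rewrite !last_cat !last_rcons => lt_pn /and3P[xp1 zp2 zp3] last_p3.
  rewrite !path_edges_cat !big_cat /= !last_rcons.
  (* The detour [rcons p2 z] is a closed walk at [z]; cutting it out leaves a shorter closed walk at
     [x]. *)
  rewrite [X in _ + (X + _)]IHn ?last_rcons ?size_rcons //; last by lia.
  rewrite add0r -[X in _ + \sum_(f <- path_edges X _) _](last_rcons x p1 z).
  rewrite -big_cat -path_edges_cat IHn ?last_cat ?last_rcons //.
    by rewrite size_cat size_rcons; lia.
  by rewrite cat_path xp1 last_rcons.
case: (lastP p) Up xp last_p {lt_pn} => [|q y]; first by rewrite big_nil.
rewrite last_rcons => Uq xq eq_yx; rewrite {y}eq_yx in Uq xq *.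
rewrite rcons_uniq in Uq.
(* With at least two vertices in [q], [x :: q] is a genuine cycle. Otherwise the walk is a loop,
   excluded by irreflexivity, or traverses one edge twice. *)
have [q_gt1|] := boolP (1 < size q)%N.
  by rewrite -cycle_edges_path // w_cycle // /is_cycle /ucycleb /= xq Uq.
case: q xq {Uq} => [|y [|//]] /=; first by rewrite adj_irr.
by rewrite /path_edges /= big_cons big_seq1 [X in _ + w X]setUC addVV.
Qed.

(** An indicator vector forgets multiplicities and non-edges, hence the two hypotheses on [s]. *)
Lemma edge_vector_mulmx (T : finType) (adj : rel T) n (w : {set T} -> 'rV_n) s :
  uniq s -> {subset s <= edges adj} ->
  edge_vector adj s *m \matrix_i w (enum_val i) = \sum_(f <- s) w f.
Proof.
move=> Us sE; rewrite mulmx_sum_row [RHS]big_uniq //=.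
transitivity (\sum_(f in edges adj) if f \in s then w f else 0).
  rewrite [RHS]big_enum_val; apply: eq_bigr => i _.
  by rewrite mxE rowK; case: (_ \in s); rewrite ?scale1r ?scale0r.
rewrite -big_mkcondr.
by apply: eq_bigl => f; apply/andb_idl/sE.
Qed.

Lemma edge_vector_cycle_space (T : finType) (adj : rel T)
    (adj_irr : irreflexive adj) c :
  is_cycle adj c -> edge_vector adj (cycle_edges c) \in cycle_space adj.
Proof.
move=> cyc_c; rewrite memv_ker lfunE /=.
pose w (f : {set T}) := \row_(j < #|T|) (enum_val j \in f)%:R : 'rV['F_2]__.
have -> : incidence_mx adj = \matrix_i w (enum_val i).
  by apply/matrixP=> i j; rewrite !mxE.
rewrite edge_vector_mulmx; first 1 last.
- exact: cycle_edges_uniq cyc_c.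
- exact: cycle_edges_sub.
apply/eqP/(@sum_cycle_edges_potential _ adj _ _ _ (fun u => w [set u])) => //.
  exact: addrr_rVF2.
move=> u v uv; apply/rowP=> j; rewrite !mxE !inE.
(* For [u = v] the incidence row would be the indicator of [u], whereas the potential sum would
   vanish. *)
have: u != v by apply: contraTneq uv => ->; rewrite adj_irr.
by case: (eqVneq (enum_val j) u) => [-> /negPf->|_ _] /=; rewrite ?addr0 ?add0r.
Qed.

Theorem theorem2p23 (T : finType) (adj : rel T)
    (adj_sym : symmetric adj) (adj_irr : irreflexive adj)
    (adj_conn : forall x y : T, connect adj x y)
    (r : T) (t k : nat) (F : 'I_t -> {set {set T}})
    (F_inj : injective F)
    (F_part : partition [set F j | j : 'I_t] (edges adj))
    (g : 'I_t -> 'rV['F_2]_k) :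
  (labeling_well_defined adj r F g <->
     (forall c : seq T, is_cycle adj c -> class_sum F g (cycle_edges c) = 0))
  /\
  (forall B : seq (seq T), is_cycle_basis adj B ->
     (forall c : seq T, c \in B -> class_sum F g (cycle_edges c) = 0) ->
     (forall c : seq T, is_cycle adj c -> class_sum F g (cycle_edges c) = 0)).
Proof.
have addVV := @addrr_rVF2 k.
split; [split=> [g_indep c cyc_c | g_cycle v p q] | move=> B].
- have [l wl] := path_independent_potential adj_sym adj_irr (adj_conn r) addVV g_indep.
  exact: sum_cycle_edges_potential wl _ cyc_c.
- case/and3P=> rp /eqP last_p _ /and3P[rq /eqP last_q _].
  (* In exponent 2 it is enough that the closed walk along [p] and back along [q] has weight 0. *)
  apply: (addr_eq0_exp2 addVV); rewrite /class_sum -[X in _ + X]sum_path_edges_rev.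
  rewrite last_q -last_p -big_cat -path_edges_cat.
  apply: (sum_closed_walk_eq0 adj_irr addVV g_cycle).
    rewrite cat_path rp last_p -last_q rev_path.
    by rewrite (eq_path (e' := adj)) // => x y; rewrite adj_sym.
  rewrite last_cat last_p -last_q; case: (q) => //= x q'.
  by rewrite rev_cons last_rcons.
- case/andP=> /allP B_cycle B_basis gB c cyc_c.
  pose w f := oapp g 0 (edge_class F f).
  have wE c' : is_cycle adj c' -> class_sum F g (cycle_edges c') =
      edge_vector adj (cycle_edges c') *m \matrix_i w (enum_val i).
    move=> cyc_c'; rewrite edge_vector_mulmx //; first exact: cycle_edges_uniq cyc_c'.
    exact: cycle_edges_sub.
  rewrite wE //; set A := \matrix_i _.
  (* The weight is now linear in the edge vector, so its vanishing on the spanning family from [B]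
     carries over to the whole cycle space. *)
  suffices: (cycle_space adj <= lker (linfun (mulmxr A)))%VS.
    move/subvP/(_ _ (edge_vector_cycle_space adj_irr cyc_c)).
    by rewrite memv_ker lfunE => /eqP.
  rewrite -(span_basis B_basis); apply/span_subvP=> _ /mapP[c' Bc' ->].
  by rewrite memv_ker lfunE /= -wE ?gB //; apply: B_cycle.
Qed.
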